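(* Let $G$ be a finite group, $K/\mathbb{Q}$ a finite Galois extension, and $\Theta=\sum_in_iH_i$ a $K$-relation for $G$. Let $\tau$ be a $\mathbb{Q}G$-representation, and let $\langle,\rangle_1$, $\langle,\rangle_2$ be two non-degenerate $\mathbb{Q}$-bilinear $G$-invariant pairings on $\tau$ that are $\mathbb{Q}$-valued. Computing the determinants with respect to the same basis of $\tau^{H_i}$ on both sides, one has $$\prod_i\det\Big(\frac1{|H_i|}\langle,\rangle_1\mid\tau^{H_i}\Big)^{n_i}\equiv\prod_i\det\Big(\frac1{|H_i|}\langle,\rangle_2\mid\tau^{H_i}\Big)^{n_i}\mod N_{K/\mathbb{Q}}(K^\times).$$
   Context: A formal sum $\Theta=\sum_in_iH_i$ of subgroups of $G$ (up to conjugacy, $n_i\in\mathbb{Z}$) is a $K$-relation for $G$ if there is $\rho$ in the complex representation ring of $G$ with $\mathbb{Q}(\rho)\subset K$ (the field generated by the character values of $\rho$) and $\bigoplus_i\mathbb{C}[G/H_i]^{\oplus n_i}=\bigoplus_{\sigma\in\mathrm{Gal}(K/\mathbb{Q})}\rho^\sigma$ as virtual representations, where $\mathrm{Tr}\,\rho^\sigma(g)=\sigma(\mathrm{Tr}\,\rho(g))$. For a $\mathbb{Q}$-vector space $V$ with pairing $\langle,\rangle$ and basis $e_1,\dots,e_n$, $\det(\langle,\rangle\mid V)=\det(\langle e_i,e_j\rangle)_{i,j}$. *)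

(* Defs.v *)
From HB Require Import structures.
From mathcomp Require Import all_boot all_order all_algebra all_fingroup.
From mathcomp Require Import all_solvable all_field all_character.

Set Implicit Arguments.
Unset Strict Implicit.
Unset Printing Implicit Defensive.

Import GroupScope GRing.Theory Num.Theory.
Local Open Scope ring_scope.

(* The complex numbers are modelled by algC, as in mathcomp's character       *)
(* theory; 'Z[irr G] inside 'CF(G) is the complex representation ring of G.   *)

Section CosetRepresentation.

Variables (gT : finGroupType) (G H : {group gT}).

(* The permutation module C[G/H]. mathcomp's representations act on row       *)
(* vectors on the right, so G/H is the right G-set of cosets H x.             *)
Definition coset_mx (g : gT) : 'M[algC]_#|rcosets H G| :=
  \matrix_(i, j) (enum_val i :* g == enum_val j)%:R.

Lemma coset_mx_repr : mx_repr G coset_mx.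
Proof.
split=> [|g h Gg Gh]; apply/matrixP=> i k; rewrite !mxE.
  by rewrite rcoset1 (inj_eq enum_val_inj).
have Xg : enum_val i :* g \in rcosets H G.
  have /rcosetsP[x Gx ->] := enum_valP i.
  by rewrite -rcosetM; apply/rcosetsP; exists (x * g)%g; rewrite ?groupM.
rewrite (bigD1 (enum_rank_in Xg (enum_val i :* g))) //= !mxE.
rewrite enum_rankK_in // eqxx mul1r rcosetM big1 ?addr0 // => j nej.
rewrite !mxE; case: eqP => [Ej|_]; last by rewrite mul0r.
by case/eqP: nej; apply: enum_val_inj; rewrite enum_rankK_in.
Qed.

Canonical coset_repr := MxRepresentation coset_mx_repr.

End CosetRepresentation.

Section KRelations.

Variables (gT : finGroupType) (G : {group gT}).
Variables (K : splittingFieldType rat) (iota : {rmorphism K -> algC}).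

(* Q(rho) is contained in K, where K is viewed in C through iota. *)
Definition char_values_in (rho : 'CF(G)) : Prop :=
  forall g, g \in G -> exists a : K, iota a = rho g.

(* rho' = rho^s *)
Definition galois_conjugate (s : gal_of {:K}) (rho rho' : 'CF(G)) : Prop :=
  forall g a, g \in G -> iota a = rho g -> rho' g = iota (s a).

(* The formal sum \sum_i n_i H_i is a K-relation for G. Virtual               *)
(* representations are compared through their characters.                     *)
Definition K_relation (I : finType) (H : I -> {group gT}) (n : I -> int) :
    Prop :=
  exists2 rho : 'CF(G), rho \in 'Z[irr G] /\ char_values_in rho
  & exists2 rho_ : gal_of {:K} -> 'CF(G),
      forall s, s \in 'Gal({:K} / 1) -> galois_conjugate s rho (rho_ s)
    & \sum_i cfRepr (coset_repr G (H i)) *~ n i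
        = \sum_(s in 'Gal({:K} / 1)) rho_ s.

End KRelations.

(* x and y represent the same class of Q^* modulo N_{K/Q}(K^* ). *)
Definition eq_mod_norms (K : splittingFieldType rat) (x y : rat) : Prop :=
  [/\ x != 0, y != 0
    & exists2 z : K, z != 0 & x%:A = y%:A * galNorm 1 {:K} z].

Section Pairings.

Variables (gT : finGroupType) (G : {group gT}) (d : nat).
Implicit Type b : 'rV[rat]_d -> 'rV[rat]_d -> rat.

Definition nondegenerate_pairing b : Prop :=
  (forall u, (forall v, b u v = 0) -> u = 0) /\
  (forall v, (forall u, b u v = 0) -> v = 0).

Definition invariant_pairing (tau : mx_representation rat G d) b : Prop :=
  forall g u v, g \in G -> b (u *m tau g) (v *m tau g) = b u v.

(* The rows of E form a basis of tau^H. *)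
Definition fixed_basis (tau : mx_representation rat G d) (H : {set gT}) m
    (E : 'M[rat]_(m, d)) : bool :=
  row_free E && (E == rfix_mx tau H)%MS.

Definition det_pairing b m (E : 'M[rat]_(m, d)) : rat :=
  \det (\matrix_(j, k) b (row j E) (row k E)).

End Pairings.

(* Main.v *)
Require Import Defs.
From HB Require Import structures.
From mathcomp Require Import all_boot all_order all_algebra all_fingroup.
From mathcomp Require Import all_solvable all_field all_character.

Set Implicit Arguments.
Unset Strict Implicit.
Unset Printing Implicit Defensive.

Import GroupScope GRing.Theory Num.Theory.
Local Open Scope ring_scope.
(** The two pairings differ by an invertible A commuting with G:
    if B1, B2 are their Gram matrices and A = B1 B2^-1, then
    b1 (u, v) = b2 (u A, v), so on tau^H the two determinants differ by the
    factor det (A | tau^H). It has to be shown that the product of the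
    det (A | tau^(H_i)) ^ n_i is a norm from K.

    For a representation rho put D(rho) = det (A | Hom_G (rho, tau)), and extend
    D multiplicatively to virtual representations. Frobenius reciprocity
    identifies tau^H with Hom_G (C[G/H], tau), so det (A | tau^H) = D(C[G/H]),
    and the product in question is D of the virtual permutation representation,
    that is, the product of the D(rho^s) over s in Gal(K/Q). Since tau and A are
    rational, automorphisms of C satisfy u (D(rho)) = D(u o rho). Those fixing K
    fix rho, hence D(rho), which therefore lies in K; and D(rho^s) = s (D(rho)),
    so the product is the norm of D(rho).

    To make this precise without comparing Hom spaces directly, everything is
    read off from the class functions phi_k (g) = tr (A^k tau(g)): the trace of
    A^k on Hom_G (rho, tau) is [phi_k, rho], and the traces of all powers of a
    matrix determine its eigenvalues with multiplicities, hence its determinant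
    (power_sums_perm_eq). Thus irr_spectrum produces the eigenvalues of A on each
    Hom_G (chi_i, tau), det_fixed_space gives det (A | tau^H) = D(C[G/H]), and the
    equivariance of D in exists_irr_dets amounts to u o phi_k = phi_k. The
    number-theoretic part is aut_fixed_num_field, and virtual_det_K_relation
    combines both. *)

(** * Spectra of matrices and power sums *)

(** The sum of the values of a polynomial over a sequence is a combination of
    power sums; a polynomial vanishing at every entry except x isolates the
    multiplicity of x. *)
Lemma power_sums_perm_eq (F : numDomainType) (s t : seq F) :
    (forall k, \sum_(x <- s) x ^+ k = \sum_(x <- t) x ^+ k) ->
  perm_eq s t.
Proof.
move=> eq_st; apply/allP=> x _ /=; apply/eqP.
have eq_poly (p : {poly F}) : \sum_(y <- s) p.[y] = \sum_(y <- t) p.[y].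
  under eq_bigr do rewrite horner_coef.
  under [RHS]eq_bigr do rewrite horner_coef.
  rewrite exchange_big [RHS]exchange_big; apply: eq_bigr => k _ /=.
  by rewrite -!mulr_sumr eq_st.
(* p vanishes at all entries of s and t other than x. *)
pose p : {poly F} := \prod_(z <- rem x (undup (s ++ t))) ('X - z%:P).
have p_x : p.[x] != 0.
  by rewrite -rootE root_prod_XsubC mem_rem_uniqF ?undup_uniq.
have p_sum (r : seq F) : {subset r <= s ++ t} ->
    \sum_(y <- r) p.[y] = p.[x] *+ count_mem x r.
  move=> r_st; rewrite (bigID (pred1 x)) /= [X in _ + X]big1_seq ?addr0.
    rewrite -big_filter (eq_big_seq (fun=> p.[x])).
      rewrite big_const_seq iter_addr_0 count_filter; congr (_ *+ _).
    by move=> y; rewrite mem_filter => /andP[/eqP-> _].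
  move=> y /andP[y'x /r_st st_y]; apply/eqP; rewrite -rootE root_prod_XsubC.
  by rewrite (rem_filter _ (undup_uniq _)) mem_filter /= y'x mem_undup.
have := eq_poly p; rewrite !p_sum; last 2 first.
- by move=> y ty; rewrite mem_cat ty orbT.
- by move=> y sy; rewrite mem_cat sy.
exact: (mulrIn p_x).
Qed.

Lemma mulmx_exp_comm (R : pzRingType) m n (E : 'M[R]_(m, n)) A B k :
  E *m A = B *m E -> E *m A ^+ k = B ^+ k *m E.
Proof.
move=> EA; elim: k => [|k IHk]; first by rewrite !expr0 mulmx1 mul1mx.
rewrite (exprS A) (exprS B) -[A * _]/(A *m _) -[B * _]/(B *m _).
by rewrite mulmxA EA -mulmxA IHk mulmxA.
Qed.

(** By Schur triangularization: the diagonal of a triangular matrix lists its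
    eigenvalues, and powers act on it entrywise. *)
Lemma exists_spectrum n (A : 'M[algC]_n) :
  exists2 s : seq algC, \det A = \prod_(x <- s) x
    & forall k, \tr (A ^+ k) = \sum_(x <- s) x ^+ k.
Proof.
case: n A => [|n] A.
  exists [::] => [|k]; first by rewrite det_mx00 big_nil.
  by rewrite big_nil /mxtrace big_ord0.
have [//|P /unitarymx_unit uP] := Schur A.
rewrite /similar_to conjumx //; set T := _ *m _ => trigT.
have trigTk k : is_trig_mx (T ^+ k) /\ forall i, (T ^+ k) i i = T i i ^+ k.
  elim: k => [|k [IHt IHd]].
    by split=> [|i]; [rewrite expr0; exact: scalar_mx_is_trig | rewrite expr0 mxE eqxx].
  have trigS (i j : 'I_n.+1) : (i <= j)%N -> (T ^+ k.+1) i j = (T i i ^+ k.+1) *+ (i == j).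
    move=> le_ij; rewrite exprS mxE (bigD1 i) //= big1 ?addr0 => [|l ne_li].
      case: eqP => [<-|/eqP ne_ij]; first by rewrite IHd exprS.
      by rewrite (is_trig_mxP IHt) ?mulr0 // ltn_neqAle ne_ij.
    have [lt_il | le_li] := ltnP i l; first by rewrite (is_trig_mxP trigT) ?mul0r.
    rewrite (is_trig_mxP IHt) ?mulr0 //.
    by apply: leq_trans le_ij; rewrite ltn_neqAle ne_li.
  split=> [|i]; last by rewrite trigS // eqxx.
  by apply/is_trig_mxP=> i j lt_ij; rewrite trigS ?(ltnW lt_ij) // -val_eqE ltn_eqF.
exists [seq T i i | i : 'I_n.+1] => [|k]; rewrite big_image /=.
  by rewrite -det_trig // !det_mulmx mulrAC -det_mulmx mulmxV // det1 mul1r.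
have PA : P *m A = T *m P by rewrite /T mulmxKV.
rewrite -[A ^+ k](mulKmx uP) (mulmx_exp_comm k PA) mxtrace_mulC mulmxK //.
by apply: eq_bigr => i _; case: (trigTk k).
Qed.

(** * Endomorphisms commuting with a representation, on its fixed vectors *)

(** Averaging over H is an idempotent P commuting with A whose image is the fixed
    space, so tr (A^k P) is the trace of A^k on that space. Factoring P through
    the basis E turns this into an identity with the matrix B of A in the
    basis E. *)
Lemma mxtrace_fixed (F : numFieldType) (gT : finGroupType) (G : {group gT}) n
    (rG : mx_representation F G n) (H : {group gT}) m (E : 'M[F]_(m, n)) A B k :
    H \subset G -> row_free E -> (E :=: rfix_mx rG H)%MS ->
    {in H, forall h, A *m rG h = rG h *m A} -> E *m A = B *m E ->
  \tr (B ^+ k) = #|H|%:R^-1 * \sum_(h in H) \tr (A ^+ k *m rG h).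
Proof.
move=> /subsetP sHG freeE fixE cAH EA.
pose P := #|H|%:R^-1 *: \sum_(h in H) rG h.
have nzH : #|H|%:R != 0 :> F by rewrite pnatr_eq0 -lt0n cardG_gt0.
have EP : E *m P = E.
  rewrite -scalemxAr mulmx_sumr (eq_bigr (fun=> E)) => [|h Hh].
    by rewrite sumr_const -scaler_nat scalerA mulVf ?scale1r.
  by apply: (rfix_mxP _ _) Hh; rewrite fixE.
have /submxP[D defP] : (P <= E)%MS.
  rewrite fixE; apply/rfix_mxP=> g Hg; rewrite -scalemxAl mulmx_suml; congr (_ *: _).
  rewrite [RHS](reindex_inj (mulIg g)); apply: eq_big => [h|h Hh].
    by rewrite groupMr.
  by rewrite repr_mxM ?sHG.
have ED : E *m D = 1%:M.
  by apply: (row_free_inj freeE); rewrite -mulmxA -defP EP mul1mx.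
have -> : #|H|%:R^-1 * \sum_(h in H) \tr (A ^+ k *m rG h) = \tr (A ^+ k *m P).
  by rewrite -scalemxAr mxtraceZ mulmx_sumr raddf_sum.
rewrite defP mulmxA mxtrace_mulC mulmxA (mulmx_exp_comm k EA) -mulmxA ED.
by rewrite mulmx1.
Qed.

Lemma fixed_restriction (F : fieldType) (gT : finGroupType) (G : {group gT}) n
    (rG : mx_representation F G n) (H : {group gT}) m (E : 'M[F]_(m, n)) A :
    (E :=: rfix_mx rG H)%MS -> {in H, forall h, A *m rG h = rG h *m A} ->
  exists B, E *m A = B *m E.
Proof.
move=> fixE cAH; apply/submxP; rewrite fixE; apply/rfix_mxP=> h Hh.
by rewrite -mulmxA cAH // mulmxA (rfix_mxP H _) ?fixE.
Qed.

Lemma det_restriction_neq0 (F : fieldType) m n (E : 'M[F]_(m, n)) A B :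
  row_free E -> A \in unitmx -> E *m A = B *m E -> \det B != 0.
Proof.
move=> freeE uA EA; rewrite -unitfE -unitmxE -row_free_unit.
rewrite /row_free -(mxrankMfree B freeE) -EA mxrankMfree ?row_free_unit //.
Qed.

(** * Permutation characters *)

(** The value at g counts the cosets H y with H y g = H y, that is, with
    y g y^-1 in H; the induced character makes the same count over the elements
    y of G, each coset occurring #|H| times. *)
Lemma cfRepr_coset (gT : finGroupType) (G H : {group gT}) : H \subset G ->
  cfRepr (coset_repr G H) = 'Ind[G] (1 : 'CF(H)).
Proof.
move=> sHG; apply/cfun_inP=> g Gg; rewrite cfIndE // cfunE Gg mulr1n.
have -> : \sum_(y in G) (1 : 'CF(H)) (g ^ y)%g
        = \sum_(y in G) (H :* y :* g == H :* y)%:R.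
  rewrite (reindex_inj invg_inj); apply: eq_big => [y|y Gy]; first exact: groupV.
  rewrite cfun1E conjgE invgK mulgA -rcosetM; congr (nat_of_bool _)%:R.
  apply/idP/eqP=> [Hyg | eqH].
    by apply/rcoset_eqP; rewrite mem_rcoset.
  by rewrite -mem_rcoset -eqH rcoset_refl.
rewrite (set_partition_big _ (rcosets_partition sHG)) /=.
rewrite (eq_bigr (fun X => #|H|%:R * (X :* g == X)%:R)) => [|X]; last first.
  case/rcosetsP=> x Gx ->; rewrite (eq_bigr (fun=> (H :* x :* g == H :* x)%:R)).
    by rewrite sumr_const card_rcoset mulr_natl.
  by move=> y /rcoset_eqP->.
rewrite -mulr_sumr mulKf ?pnatr_eq0 -?lt0n ?cardG_gt0 //.
rewrite (big_enum_val (fun X : {set gT} => (X :* g == X)%:R)).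
by apply: eq_bigr => i _; rewrite mxE.
Qed.

(** * Multiplicative functions of virtual characters *)

(** The homomorphism from the group of virtual characters to C^* sending 'chi_i
    to D i. The multiplicities are integers, and taking the floor only converts
    them to the type int. *)
Definition virtual_det (gT : finGroupType) (G : {group gT})
    (D : Iirr G -> algC) (phi : 'CF(G)) : algC :=
  \prod_i D i ^ Num.floor '[phi, 'chi_i].

Section VirtualDet.

Variables (gT : finGroupType) (G : {group gT}) (D : Iirr G -> algC).
Hypothesis nzD : forall i, D i != 0.

Lemma virtual_det_neq0 phi : virtual_det D phi != 0.
Proof. by apply/prodf_neq0=> i _; rewrite expfz_neq0. Qed.

Lemma virtual_det0 : virtual_det D 0 = 1.
Proof. by apply: big1 => i _; rewrite cfdot0l floor0 expr0z. Qed.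

Lemma virtual_detD : {in 'Z[irr G] &, forall phi psi,
  virtual_det D (phi + psi) = virtual_det D phi * virtual_det D psi}.
Proof.
move=> phi psi Zphi Zpsi; rewrite -big_split; apply: eq_bigr => i _ /=.
rewrite cfdotDl real_floorDzr ?Cint_cfdot_vchar_irr // ?expfzDr //.
by rewrite Rreal_int ?Cint_cfdot_vchar_irr.
Qed.

Lemma virtual_det_sum (J : finType) (P : pred J) (phi : J -> 'CF(G)) :
    (forall j, P j -> phi j \in 'Z[irr G]) ->
  virtual_det D (\sum_(j | P j) phi j) = \prod_(j | P j) virtual_det D (phi j).
Proof.
move=> Zphi; suff [] : \sum_(j | P j) phi j \in 'Z[irr G] /\
    virtual_det D (\sum_(j | P j) phi j) = \prod_(j | P j) virtual_det D (phi j).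
- by [].
elim/big_rec2: _ => [|j x y Pj [Zy <-]]; first by rewrite rpred0 virtual_det0.
by rewrite rpredD ?virtual_detD ?Zphi.
Qed.

Lemma virtual_detMz phi (n : int) : phi \in 'Z[irr G] ->
  virtual_det D (phi *~ n) = virtual_det D phi ^ n.
Proof.
move=> Zphi; rewrite /virtual_det.
rewrite (big_morph (fun x : algC => x ^ n) (fun x y => expfzMl x y n) (exp1rz _ n)).
apply: eq_bigr => i _; rewrite exprz_exp -scaler_int cfdotZl; congr (_ ^ _).
by rewrite floorM ?Cint_cfdot_vchar_irr ?rpred_int // intrKfloor mulrC.
Qed.

(** An automorphism of C permutes the irreducible characters and preserves the
    integral multiplicities. *)
Lemma virtual_det_aut (u : {rmorphism algC -> algC}) phi :
    (forall i, D (aut_Iirr u i) = u (D i)) -> phi \in 'Z[irr G] ->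
  virtual_det D (cfAut u phi) = u (virtual_det D phi).
Proof.
move=> uD Zphi; rewrite rmorph_prod /virtual_det.
have inj_u : injective (@aut_Iirr _ G u).
  by move=> i j /(congr1 (tnth (irr G))); rewrite !aut_IirrE => /cfAut_inj/irr_inj.
rewrite (reindex_inj inj_u); apply: eq_bigr => i _ /=.
rewrite uD aut_IirrE cfdot_aut_irr -rmorphXz ?unitfE //.
have /intrP[c ->] := Cint_cfdot_vchar_irr i Zphi.
by rewrite rmorph_int.
Qed.

End VirtualDet.

(** * Determinants on multiplicity spaces *)

Section CommutingEndomorphism.

Variables (gT : finGroupType) (G : {group gT}) (d : nat).
Variables (rG : mx_representation algC G d) (A : 'M[algC]_d).
Hypothesis cAG : {in G, forall g, A *m rG g = rG g *m A}.

Fact trace_class_fun k : is_class_fun <<G>>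
  [ffun g => \tr (A ^+ k *m rG g) *+ (g \in G)].
Proof.
rewrite genGid; apply: intro_class_fun => [x y Gx Gy | _ /negbTE-> //].
rewrite groupJr // conjgE !repr_mxM ?groupM ?groupV // !mulmxA.
have /(mulmx_exp_comm k) cAy := esym (cAG (groupVr Gy)).
by rewrite -cAy mxtrace_mulC !mulmxA -repr_mxM ?groupV // mulgV repr_mx1 mul1mx.
Qed.
Definition trace_cfun k := Cfun 0 (trace_class_fun k).

Lemma trace_cfunE k g : g \in G -> trace_cfun k g = \tr (A ^+ k *m rG g).
Proof. by move=> Gg; rewrite cfunE Gg. Qed.

(** The sequence s lists the eigenvalues of A on Hom_G (chi_i, tau), realised as
    the G-fixed vectors of the tensor product of tau with the dual of chi_i. Its
    product does not vanish because A is invertible. *)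
Lemma irr_spectrum i : A \in unitmx ->
  exists2 s : seq algC, \prod_(x <- s) x != 0
    & forall k, '[trace_cfun k, 'chi_i] = \sum_(x <- s) x ^+ k.
Proof.
move=> uA.
pose rX := prod_repr 'Chi_(conjC_Iirr i) rG.
pose X := tprod (1%:M : 'M[algC]_(irr_degree (socle_of_Iirr (conjC_Iirr i)))) A.
have uX : X \in unitmx.
  apply: (proj1 (mulmx1_unit (B := tprod 1%:M (invmx A)) _)).
  by rewrite -tprodE mulmxV // mul1mx tprod1.
have cXG : {in G, forall g, X *m rX g = rX g *m X}.
  by move=> g Gg; rewrite /= -!tprodE mul1mx mulmx1 cAG.
have Xk k : X ^+ k = tprod 1%:M (A ^+ k).
  elim: k => [|k IHk]; first by rewrite !expr0 tprod1.
  by rewrite (exprS X) (exprS A) IHk -[X * _]/(X *m _) -tprodE mul1mx.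
pose E := row_base (rfix_mx rX G).
have fixE : (E :=: rfix_mx rX G)%MS := eq_row_base _.
have [B EX] := fixed_restriction fixE cXG.
have [s detB trB] := exists_spectrum B.
exists s => [|k].
  by rewrite -detB; apply: det_restriction_neq0 EX; rewrite ?row_base_free.
rewrite -trB (mxtrace_fixed k (subxx G) (row_base_free _) fixE cXG EX) cfdotE.
congr (_ * _); apply: eq_bigr => g Gg.
rewrite trace_cfunE // Xk -tprodE mul1mx mxtrace_prod mulrC; congr (_ * _).
by rewrite -cfConjCE -conjC_IirrE -irrRepr cfunE Gg.
Qed.

(** By Frobenius reciprocity the trace of A^k on the H-fixed vectors is
    [phi_k, Ind 1], so the spectrum of A there is the union of the spectra s i,
    each repeated as often as 'chi_i occurs in Ind 1. *)
Lemma det_fixed_space (s : Iirr G -> seq algC) (H : {group gT}) m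
    (E : 'M[algC]_(m, d)) B :
    (forall i k, '[trace_cfun k, 'chi_i] = \sum_(x <- s i) x ^+ k) ->
    H \subset G -> row_free E -> (E :=: rfix_mx rG H)%MS -> E *m A = B *m E ->
  \det B = virtual_det (fun i => \prod_(x <- s i) x) ('Ind[G] (1 : 'CF(H))).
Proof.
move=> s_i sHG freeE fixE EA; set chi := 'Ind _.
have Nchi : chi \is a character by rewrite cfInd_char ?cfun1_char.
pose c i := Num.trunc '[chi, 'chi_i].
have cE i : '[chi, 'chi_i] = (c i)%:R by rewrite truncnK // Cnat_cfdot_char_irr.
have [t -> trB] := exists_spectrum B.
pose t' := flatten [seq flatten (nseq (c i) (s i)) | i : Iirr G].
have big_t' (idx : algC) (op : Monoid.com_law idx) (F : algC -> algC) :
  \big[op/idx]_(x <- t') F x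
    = \big[op/idx]_i iter (c i) (op (\big[op/idx]_(x <- s i) F x)) idx.
- rewrite big_flatten big_image /=; apply: eq_bigr => i _.
  by rewrite big_flatten big_nseq.
rewrite (perm_big t') /=; last first.
  apply: power_sums_perm_eq => k; rewrite big_t' -trB.
  rewrite (mxtrace_fixed k sHG freeE fixE _ EA) => [|h /(subsetP sHG)/cAG //].
  transitivity '[trace_cfun k, chi].
    rewrite cfdotC -Frobenius_reciprocity -cfdotC cfdotE; congr (_ * _).
    apply: eq_bigr => h Hh; rewrite cfResE // trace_cfunE ?(subsetP sHG) //.
    by rewrite cfun1E Hh conjC1 mulr1.
  rewrite cfdot_sum_irr; apply: eq_bigr => i _.
  by rewrite cE conjC_nat s_i iter_addr_0 mulr_natr.
rewrite big_t'; apply: eq_bigr => i _.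
by rewrite iter_mulr_1 cE -[(c i)%:R]/((c i)%:~R) intrKfloor.
Qed.

End CommutingEndomorphism.

(** Here D i is the determinant of A on Hom_G (chi_i, tau). Its compatibility
    with automorphisms u of C uses the rationality of A and tau: u fixes every
    phi_k, hence maps the power sums of the spectrum attached to 'chi_i to those
    of the spectrum attached to the conjugate character. *)
Lemma exists_irr_dets (gT : finGroupType) (G : {group gT}) d
    (tau : mx_representation rat G d) (A : 'M[rat]_d) :
    {in G, forall g, A *m tau g = tau g *m A} -> A \in unitmx ->
  exists D : Iirr G -> algC,
    [/\ forall i, D i != 0,
        forall (u : {rmorphism algC -> algC}) i, D (aut_Iirr u i) = u (D i)
      & forall (H : {group gT}) m (E : 'M[rat]_(m, d)) B,
          H \subset G -> fixed_basis tau H E -> E *m A = B *m E ->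
        ratr (\det B) = virtual_det D ('Ind[G] (1 : 'CF(H)))].
Proof.
move=> cAtau uA; pose rG := map_repr (ratr : {rmorphism rat -> algC}) tau.
pose AC := map_mx (ratr : {rmorphism rat -> algC}) A.
have cAG : {in G, forall g, AC *m rG g = rG g *m AC}.
  by move=> g Gg; rewrite map_reprE -!map_mxM cAtau.
have uAC : AC \in unitmx by rewrite map_unitmx.
have [s nz_s sE] := fin_all_exists2 (fun i => irr_spectrum cAG i uAC).
have AXk k : AC ^+ k = map_mx ratr (A ^+ k).
  elim: k => [|k IHk]; first by rewrite !expr0 map_mx1.
  by rewrite (exprS AC) (exprS A) IHk -[AC * _]/(AC *m _) -map_mxM.
exists (fun i => \prod_(x <- s i) x); split=> // [u i | H m E B sHG].
  rewrite rmorph_prod -(big_map u xpredT id) /=; apply: perm_big.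
  apply: power_sums_perm_eq => k; rewrite big_map -sE aut_IirrE.
  have /esym {1}-> : cfAut u (trace_cfun cAG k) = trace_cfun cAG k.
    apply/cfun_inP=> g Gg; rewrite [LHS]cfunE trace_cfunE // AXk map_reprE -map_mxM.
    by rewrite trace_map_mx fmorph_rat.
  by rewrite cfdot_aut_irr sE rmorph_sum; apply: eq_bigr => x _; rewrite rmorphXn.
case/andP=> freeE /eqmxP fixE EA; rewrite -det_map_mx.
apply: (det_fixed_space sE sHG (E := map_mx ratr E)).
- by rewrite row_free_map.
- by rewrite -map_rfix_mx; apply/map_eqmx.
by rewrite -!map_mxM EA.
Qed.

(** * Galois descent in the algebraic numbers *)

(** A field generated by all the roots of the minimal polynomial of z. *)
Lemma algC_in_splitting_field (z : algC) :
  exists (L : splittingFieldType rat) (LC : {rmorphism L -> algC}) (y : L),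
    LC y = z.
Proof.
have [p [_ mon_p] /(_ p)] := minCpolyP z; rewrite dvdpp => pz0.
have [r Dr] := closed_field_poly_normal (map_poly ratr p : {poly algC}).
rewrite lead_coef_map (monicP mon_p) rmorph1 scale1r in Dr.
have rz : z \in r by rewrite -root_prod_XsubC -Dr.
have [Q [QC [rr Drr genQ]]] := num_field_exists r.
have splitQ : SplittingField.axiom Q.
  exists (map_poly (in_alg Q) p).
    by apply/polyOverP=> i; rewrite coef_map memvZ ?memv_line.
  exists rr => //; congr (_ %= _): (eqpxx (map_poly (in_alg Q) p)).
  apply/(map_poly_inj QC); rewrite -map_poly_comp.
  have -> : map_poly (QC \o in_alg Q) p = map_poly ratr p.
    by apply: eq_map_poly => a; rewrite /= rmorphZ_num rmorph1 mulr1.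
  rewrite Dr -Drr big_map rmorph_prod /=.
  by apply: eq_bigr => y _; rewrite map_polyXsubC.
pose L : splittingFieldType rat :=
  HB.pack (FieldExt.sort Q) (FieldExt_isSplittingField.Build rat Q splitQ).
move: rz; rewrite -Drr => /mapP[y _ ->].
by exists L, QC, y.
Qed.

(** A splitting field L containing iota K and x is Galois over the image of K.
    Every element of Gal(L/K) extends to an automorphism of C, so fixes x, and
    the fixed field of Gal(L/K) is K. *)
Lemma aut_fixed_num_field (K : fieldExtType rat) (iota : {rmorphism K -> algC})
    (x : algC) :
    (forall u : {rmorphism algC -> algC},
       (forall a, u (iota a) = iota a) -> u x = x) ->
  exists a, iota a = x.
Proof.
move=> fix_x; pose b := vbasis {:K}.
(* z generates a number field containing x and the image of K: px and ps express
   x and the image of a basis of K as polynomials in z. *)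
have [z _ [[|px ps] //= [Dx Db]]] := algC_PET (x :: map iota b).
have [L [LC [y Dz]]] := algC_in_splitting_field z.
pose ev p : L := (map_poly (in_alg L) p).[y].
have evE p : LC (ev p) = (map_poly ratr p).[z].
  rewrite -horner_map Dz -map_poly_comp; congr (_.[_]).
  by apply: eq_map_poly => a; rewrite /= rmorphZ_num rmorph1 mulr1.
have jP a : {c | iota a = LC c}.
  exists (\sum_i coord b i a *: ev ps`_i).
  rewrite {1}(coord_vbasis (memvf a)) !rmorph_sum /=; apply: eq_bigr => i _.
  rewrite 2!rmorphZ_num -(nth_map _ 0) ?size_tuple // Db.
  rewrite (nth_map 0) ?evE //.
  by have:= congr1 size Db; rewrite !size_map size_tuple => <-.
(* j is the embedding of K into L induced by iota. *)
pose j a := sval (jP a).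
have Dj a : iota a = LC (j a) by rewrite /j; case: (jP a).
pose rwM := (=^~ Dj, rmorphZ_num, rmorph1, rmorphB, rmorphM).
have jB : zmod_morphism j by move=> ? ?; apply: (fmorph_inj LC); rewrite !rwM.
have jM : monoid_morphism j.
  by split; try move=> ? ?; apply: (fmorph_inj LC); rewrite !rwM /= ?rwM.
have jZ : scalable j by try move=> ? ?; apply: (fmorph_inj LC); rewrite !rwM.
pose jm : {lrmorphism K -> L} := HB.pack j
  (GRing.isZmodMorphism.Build _ _ j jB) (GRing.isMonoidMorphism.Build _ _ j jM)
  (GRing.isScalable.Build _ _  _ _ j jZ).
pose M := (linfun_ahom jm @: {:K})%AS.
have memM c : reflect (exists a, c = j a) (c \in M).
  apply: (iffP memv_imgP) => [[a _ ->] | [a ->]]; first by exists a; rewrite lfunE.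
  by exists a; rewrite ?memvf ?lfunE.
have galM : galois M {:L}.
  rewrite /galois subvf normalFieldf andbT; apply/(@separableP _ _ M {:L}%AS)=> c _.
  by apply: pcharf0_separable => q; rewrite pchar_lalg pchar_num.
have [a Da] : exists a, ev px = j a.
  apply/memM; rewrite -(galois_fixedField galM); apply/fixedFieldP=> [|s galMs].
    exact: memvf.
  have [u Du] := extend_algC_subfield_aut LC s.
  apply: (fmorph_inj LC); rewrite Du !evE -Dx; apply: fix_x => a.
  rewrite Dj -Du; congr (LC _); apply: (fixed_gal (subvf M) galMs).
  by apply/memM; exists a.
by exists a; rewrite Dj -Da evE.
Qed.

(** * The norm attached to a K-relation *)

(** The element z is D(rho). Automorphisms of C over K fix rho, so D(rho) lies in
    K by Galois descent; and s in Gal(K/Q), extended to C, maps rho to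
    rho_ s, so that s z = D(rho_ s). The relation then turns the product of the
    D(C[G/H_i]) ^ n_i into the product of the conjugates of z. *)
Lemma virtual_det_K_relation (gT : finGroupType) (G : {group gT})
    (K : splittingFieldType rat) (iota : {rmorphism K -> algC})
    (I : finType) (H : I -> {group gT}) (n : I -> int) (D : Iirr G -> algC) :
    (forall i, D i != 0) ->
    (forall (u : {rmorphism algC -> algC}) i, D (aut_Iirr u i) = u (D i)) ->
    K_relation G iota H n ->
  exists2 z : K, z != 0
    & \prod_i virtual_det D (cfRepr (coset_repr G (H i))) ^ n i
        = iota (galNorm 1 {:K} z).
Proof.
move=> nzD autD [rho [Zrho K_rho] [rho_ conj_rho eq_rho]].
have [z Dz] : exists z, iota z = virtual_det D rho.
  apply: aut_fixed_num_field => u fix_u.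
  rewrite -(virtual_det_aut nzD (autD u) Zrho); congr (virtual_det D _).
  by apply/cfun_inP=> g /K_rho[a Da]; rewrite cfunE /= -Da fix_u.
exists z; first by rewrite -(fmorph_eq0 iota) Dz virtual_det_neq0.
have rho_aut s : s \in 'Gal({:K} / 1) -> exists2 u : {rmorphism algC -> algC},
    rho_ s = cfAut u rho & iota (s z) = u (iota z).
- move=> Gs; have [u Du] := extend_algC_subfield_aut iota s.
  exists u; last by rewrite -Du.
  apply/cfun_inP=> g Gg; have [a Da] := K_rho g Gg.
  by rewrite (conj_rho s Gs g a Gg Da) [RHS]cfunE /= -Da -Du.
have Zperm i : cfRepr (coset_repr G (H i)) \in 'Z[irr G].
  exact: char_vchar (cfRepr_char _).
transitivity (virtual_det D (\sum_i cfRepr (coset_repr G (H i)) *~ n i)).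
  rewrite virtual_det_sum // => [|i _]; last by rewrite rpredMz.
  by apply: eq_bigr => i _; rewrite virtual_detMz.
rewrite eq_rho virtual_det_sum // => [|s Gs]; last first.
  by have [u -> _] := rho_aut s Gs; rewrite cfAut_vchar.
rewrite rmorph_prod; apply: eq_bigr => s Gs /=.
by have [u -> ->] := rho_aut s Gs; rewrite virtual_det_aut // Dz.
Qed.

(** * Invariant pairings *)

Section Pairing.

Variables (gT : finGroupType) (G : {group gT}) (d : nat).
Variables (tau : mx_representation rat G d) (b : {biscalar 'rV[rat]_d}).

Lemma pairing_mxE u v : b u v = (u *m matrix_of_form b *m v^T) 0 0.
Proof.
rewrite {1}[u]row_sum_delta {1}[v]row_sum_delta linear_sum [RHS]mxE /=.
apply: eq_bigr => j _; rewrite linear_sumlz !mxE mulr_suml /=.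
by apply: eq_bigr => i _; rewrite linearZlr mxE /= mulrCA mulrC.
Qed.

Lemma pairing_row_mxE m (E : 'M[rat]_(m, d)) i j :
  b (row i E) (row j E) = (E *m matrix_of_form b *m E^T) i j.
Proof.
rewrite pairing_mxE -row_mul mxE [RHS]mxE.
by apply: eq_bigr => k _; rewrite !mxE.
Qed.

Lemma det_pairingE c m (E : 'M[rat]_(m, d)) :
  det_pairing (fun u v => c * b u v) E
    = \det (c *: (E *m matrix_of_form b *m E^T)).
Proof.
congr (\det _); apply/matrixP=> i j.
by rewrite mxE pairing_row_mxE [RHS]mxE.
Qed.

Hypothesis nondeg_b : nondegenerate_pairing b.

Lemma pairing_mx_unit : matrix_of_form b \in unitmx.
Proof.
rewrite -row_free_unit; apply: inj_row_free => u u0.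
by apply: (proj1 nondeg_b) => v; rewrite pairing_mxE u0 mul0mx mxE.
Qed.

Hypothesis inv_b : invariant_pairing tau b.

Lemma pairing_mx_inv g : g \in G ->
  tau g *m matrix_of_form b *m (tau g)^T = matrix_of_form b.
Proof.
move=> Gg; apply/matrixP=> i j.
by rewrite -pairing_row_mxE mxE !rowE inv_b.
Qed.

(** The pairing stays non-degenerate on tau^H: for u fixed by H, pairing u with v
    gives the same value as pairing u with the average of v over H. *)
Lemma det_pairing_fixed_neq0 c (H : {group gT}) m (E : 'M[rat]_(m, d)) :
    c != 0 -> H \subset G -> fixed_basis tau H E ->
  det_pairing (fun u v => c * b u v) E != 0.
Proof.
move=> nz_c /subsetP sHG /andP[freeE /eqmxP fixE].
rewrite det_pairingE detZ mulf_neq0 ?expf_neq0 // -unitfE -unitmxE -row_free_unit.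
apply: inj_row_free => w w0; apply: (row_free_inj freeE); rewrite /= mul0mx.
apply: (proj1 nondeg_b) => v.
pose Pv := \sum_(h in H) v *m tau h.
have /submxP[x Dx] : (Pv <= E)%MS.
  rewrite fixE; apply/rfix_mxP=> g Hg; rewrite mulmx_suml.
  rewrite [RHS](reindex_inj (mulIg g)); apply: eq_big => [h|h Hh].
    by rewrite groupMr.
  by rewrite repr_mxM ?sHG ?mulmxA.
have : b (w *m E) Pv = 0.
  by rewrite Dx pairing_mxE trmx_mul !mulmxA -(mulmxA w) -(mulmxA w) w0 mul0mx mxE.
rewrite linear_sumr (eq_bigr (fun=> b (w *m E) v)) => [/eqP|h Hh].
  by rewrite sumr_const mulrn_eq0 eqn0Ngt cardG_gt0 => /eqP.
rewrite -[RHS](@inv_b h) ?sHG //; congr (b _ _).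
by rewrite (rfix_mxP H _) // -fixE submxMl.
Qed.

End Pairing.

Theorem proposition2p34
  (gT : finGroupType) (G : {group gT})
  (K : splittingFieldType rat) (galK : galois 1 {:K})
  (iota : {rmorphism K -> algC})
  (I : finType) (H : I -> {group gT}) (n : I -> int)
  (sHG : forall i, H i \subset G)
  (Theta : K_relation G iota H n)
  (d : nat) (tau : mx_representation rat G d)
  (b1 b2 : {biscalar 'rV[rat]_d})
  (nondeg1 : nondegenerate_pairing b1) (nondeg2 : nondegenerate_pairing b2)
  (inv1 : invariant_pairing tau b1) (inv2 : invariant_pairing tau b2)
  (m : I -> nat) (E : forall i, 'M[rat]_(m i, d))
  (basisE : forall i, fixed_basis tau (H i) (E i)) :
  eq_mod_norms K
    (\prod_i det_pairing (fun u v => #|H i|%:R^-1 * b1 u v) (E i) ^ n i)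
    (\prod_i det_pairing (fun u v => #|H i|%:R^-1 * b2 u v) (E i) ^ n i).
Proof.
set B1 := matrix_of_form b1; set B2 := matrix_of_form b2.
have uB1 : B1 \in unitmx := pairing_mx_unit nondeg1.
have uB2 : B2 \in unitmx := pairing_mx_unit nondeg2.
(* A carries the second pairing to the first: b1 (u, v) = b2 (u A, v). *)
have [A uA AB2] : exists2 A, A \in unitmx & A *m B2 = B1.
  by exists (B1 *m invmx B2); rewrite ?mulmxKV // unitmx_mul uB1 unitmx_inv.
have cAtau : {in G, forall g, A *m tau g = tau g *m A}.
  move=> g Gg; have uX : B2 *m (tau g)^T \in unitmx.
    by rewrite unitmx_mul uB2 unitmx_tr repr_mx_unit.
  (* Both A (tau g) and (tau g) A become B1 when multiplied by B2 (tau g)^T. *)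
  apply: (can_inj (mulmxK uX)); rewrite /= -!mulmxA (mulmxA (tau g) B2).
  rewrite (pairing_mx_inv inv2 Gg) AB2 (mulmxA A) AB2.
  by rewrite mulmxA (pairing_mx_inv inv1 Gg).
have nzH i : (#|H i|%:R^-1 : rat) != 0.
  by rewrite invr_eq0 pnatr_eq0 -lt0n cardG_gt0.
have nz1 i := det_pairing_fixed_neq0 nondeg1 inv1 (nzH i) (sHG i) (basisE i).
have nz2 i := det_pairing_fixed_neq0 nondeg2 inv2 (nzH i) (sHG i) (basisE i).
have [D [nzD autD detD]] := exists_irr_dets cAtau uA.
have [z nz_z Dz] := virtual_det_K_relation nzD autD Theta.
have /fin_all_exists[C EA] i : exists C, E i *m A = C *m E i.
  have /andP[_ /eqmxP fixE] := basisE i; apply: fixed_restriction fixE _.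
  by move=> h /(subsetP (sHG i))/cAtau.
split; try by apply/prodf_neq0=> i _; rewrite expfz_neq0.
exists z => //; apply: (fmorph_inj iota).
rewrite rmorphM -Dz !alg_num_field !fmorph_rat !rmorph_prod -big_split /=.
apply: eq_bigr => i _; rewrite cfRepr_coset // -(detD (H i) _ (E i) (C i)) //.
rewrite !det_pairingE -/B1 -/B2 -AB2 mulmxA EA -!mulmxA scalemxAr det_mulmx.
by rewrite mulmxA expfzMl rmorphM !fmorphXz mulrC.
Qed.
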